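(* Let $R = (v_1, v_2, \ldots, v_n, \ldots)$ be a ray and let $l_R\colon V(R) \to \mathbb{R}^+$ be a non-degenerate labeling. Then the following statements are equivalent: (i) The ultrametric space $(V(R), d_{l_R})$ is locally finite. (ii) $\limsup_{n \to \infty} l_R(v_n) = \infty$.
   Context: A ray $R=(v_1,v_2,\ldots,v_n,\ldots)$ is the infinite graph with $V(R)=\{v_1,v_2,\ldots\}$, all $v_n$ distinct, and $E(R)=\{\{v_n,v_{n+1}\}\colon n\in\mathbb{N}\}$; it is a tree (connected, nonempty, without cycles), and any two distinct vertices of a tree are joined by exactly one (finite) path. $\mathbb{R}^+ = [0,\infty)$. A labeling of a tree $T$ is a map $l \colon V(T)\to\mathbb{R}^+$; it is non-degenerate if $\max\{l(u),l(v)\}>0$ for every edge $\{u,v\}\in E(T)$. Given a labeling $l$, define $d_l\colon V(T)\times V(T)\to\mathbb{R}^+$ by $d_l(u,u)=0$ and, for $u\neq v$, $d_l(u,v)=\max_{w\in V(P)} l(w)$, where $P$ is the path joining $u$ and $v$ in $T$ (endpoints included). It is known that $d_l$ is an ultrametric on $V(T)$ if and only if $l$ is non-degenerate. A subset $A$ of a metric space $(X,d)$ is bounded if $A\subseteq B_r(c)=\{x\in X\colon d(c,x)\le r\}$ for some $c\in X$, $r>0$. A metric space is locally finite if every bounded subset of it is finite. *)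

(* Defs.v *)
From HB Require Import structures.
From mathcomp Require Import all_boot all_order all_algebra.
From mathcomp Require Import all_classical all_reals all_analysis.

Set Implicit Arguments.
Unset Strict Implicit.
Unset Printing Implicit Defensive.

Import Order.TTheory GRing.Theory Num.Theory.
Local Open Scope classical_set_scope.
Local Open Scope ring_scope.

Record graph := Graph {
  vertex :> choiceType;
  adj : rel vertex;
  adj_sym : symmetric adj;
  adj_irr : irreflexive adj }.

(* The path has the vertices [u :: p]. *)
Definition is_path (G : graph) (u v : G) (p : seq G) : bool :=
  [&& path (@adj G) u p, uniq (u :: p) & last u p == v].

Definition connected_graph (G : graph) : Prop :=
  forall u v : G, exists p, is_path u v p.

Definition acyclic (G : graph) : Prop :=
  forall c : seq G, (2 < size c)%N -> ~ ucycle (@adj G) c.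

Definition is_tree (G : graph) : Prop :=
  [/\ inhabited G, connected_graph G & acyclic G].

Record tree := Tree {
  tree_graph :> graph;
  tree_axiom : is_tree tree_graph }.

Lemma tree_connected (T : tree) : connected_graph T.
Proof. by case: (tree_axiom T). Qed.

(* The path joining [u] and [v]; it is unique by [is_path_uniq] below. *)
Definition tree_path (T : tree) (u v : T) : seq T :=
  xchoose (tree_connected u v).

(* Indices start at 0, so that [ray_vertex R n] is v_{n+1}. *)
Record ray := Ray {
  ray_graph : graph;
  ray_vertex : nat -> ray_graph;
  ray_vertex_inj : injective ray_vertex;
  ray_vertex_surj : range ray_vertex = [set: ray_graph];
  ray_adjP : forall x y : ray_graph,
    adj x y <->
    exists n, [set x; y] = [set ray_vertex n; ray_vertex n.+1] }.

Definition labeling (K : realType) (G : graph) := G -> {nonneg K}.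

Definition non_degenerate (K : realType) (G : graph) (l : labeling K G) : Prop :=
  forall u v : G, adj u v -> 0 < Num.max (l u)%:num (l v)%:num.

(* Labels are nonnegative, so the 0 seeding the iterated maximum is harmless. *)
Definition label_dist (K : realType) (T : tree) (l : labeling K T)
    (u v : T) : K :=
  if u == v then 0
  else \big[Num.max/0]_(w <- u :: tree_path u v) (l w)%:num.

Section GraphTheory.
Variable G : graph.
Implicit Types (u v x y : G) (p q : seq G).

Lemma is_path_shorten u p : path (@adj G) u p ->
  exists2 q, is_path u (last u p) q & {subset q <= p}.
Proof.
move=> up; case: (shortenP up) => q uq uniq_q sub.
by exists q => //; rewrite /is_path uq uniq_q eqxx.
Qed.

Lemma path_rev u p : path (@adj G) u p ->
  path (@adj G) (last u p) (rev (belast u p)).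
Proof.
rewrite rev_path; apply: sub_path => x y; by rewrite /= adj_sym.
Qed.

Lemma is_path_uniq (u v : G) p q : acyclic G ->
  is_path u v p -> is_path u v q -> p = q.
Proof.
move=> acG; elim: p u q => [|a p IHp] u q.
  case/and3P=> _ _ /eqP /= <-; case: q => // b q /and3P[_].
  move=> /= /andP[/negP nu _] /eqP e; case: nu.
  by rewrite -[X in X \in _]e mem_last.
case: q => [|b q].
  move=> /and3P[_ /= /andP[/negP nu _] /eqP e] /and3P[_ _ /eqP /= uv].
  by case: nu; rewrite uv -[X in X \in _]e mem_last.
move=> /and3P[/= /andP[ua ap] /andP[nu up] /eqP e].
move=> /and3P[/= /andP[ub bq] /andP[nu' uq] /eqP e'].
have [ab|nab] := eqVneq a b.
  subst b; congr (_ :: _); apply: (IHp a).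
    by rewrite /is_path ap e eqxx /= up.
  by rewrite /is_path bq e' eqxx /= uq.
exfalso.
have wab : path (@adj G) a (p ++ rev (belast b q)).
  by rewrite cat_path ap e -e' path_rev.
have lab : last a (p ++ rev (belast b q)) = b.
  rewrite last_cat e; case: q {nu' uq bq wab} e' => [|c q] //= _.
  by rewrite rev_cons last_rcons.
have [s] := is_path_shorten wab; rewrite lab => /and3P[as_ us /eqP ls] sub.
apply: (acG [:: u, a & s]).
  by case: s ls {as_ us sub} => //= eab; rewrite eab eqxx in nab.
apply/andP; split.
  by rewrite /= rcons_path ua as_ ls adj_sym.
rewrite cons_uniq us andbT inE negb_or.
move: nu; rewrite inE negb_or => /andP[-> nup] /=.
apply/negP => /sub; rewrite mem_cat (negbTE nup) mem_rev /= => /mem_belast.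
by apply/negP.
Qed.

End GraphTheory.

Section TreeTheory.
Variable T : tree.
Implicit Types (u v : T) (p : seq T).

Lemma tree_pathP u v : is_path u v (tree_path u v).
Proof. exact: xchooseP (tree_connected u v). Qed.

Lemma tree_path_unique u v p : is_path u v p -> tree_path u v = p.
Proof.
by move=> uvp; apply: is_path_uniq (tree_pathP u v) uvp; case: (tree_axiom T).
Qed.

Lemma tree_path_sub u p : path (@adj T) u p ->
  {subset u :: tree_path u (last u p) <= u :: p}.
Proof.
move=> /is_path_shorten[q /tree_path_unique -> sub] x.
by rewrite !inE => /orP[->//|/sub ->]; rewrite orbT.
Qed.

End TreeTheory.

Section RayIsTree.
Variable R : ray.
Let v := @ray_vertex R.

Lemma ray_adj_cases m n : adj (v m) (v n) -> (n = m.+1 \/ m = n.+1)%N.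
Proof.
move=> /ray_adjP[k e].
have mk : v m = v k \/ v m = v k.+1.
  by have : [set v m; v n] (v m); [left|rewrite e].
have nk : v n = v k \/ v n = v k.+1.
  by have : [set v m; v n] (v n); [right|rewrite e].
have km : v k = v m \/ v k = v n.
  by have : [set v k; v k.+1] (v k); [left|rewrite -e].
have kn : v k.+1 = v m \/ v k.+1 = v n.
  by have : [set v k; v k.+1] (v k.+1); [right|rewrite -e].
case: mk => /ray_vertex_inj ?; case: nk => /ray_vertex_inj ?; subst => //.
- by case: kn => /ray_vertex_inj /esym/n_Sn.
- by left.
- by right.
- by case: km => /ray_vertex_inj /n_Sn.
Qed.

Lemma ray_adjS n : adj (v n) (v n.+1).
Proof. by apply/ray_adjP; exists n. Qed.

Lemma ray_index x : exists n, v n = x.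
Proof.
have : [set: ray_graph R] x by [].
by rewrite -(ray_vertex_surj R) => -[n _ <-]; exists n.
Qed.

Lemma ray_walk0 n : exists2 p, path (@adj (ray_graph R)) (v 0%N) p &
  last (v 0%N) p = v n.
Proof.
elim: n => [|n [p pp lp]]; first by exists [::].
exists (rcons p (v n.+1)); last by rewrite last_rcons.
by rewrite rcons_path pp lp ray_adjS.
Qed.

Lemma ray_connected : connected_graph (ray_graph R).
Proof.
move=> x y; have [m <-] := ray_index x; have [n <-] := ray_index y.
have [p pp lp] := ray_walk0 m; have [q qq lq] := ray_walk0 n.
have l0 : last (v m) (rev (belast (v 0%N) p)) = v 0%N.
  by case: p {pp} lp => [|a p] //= _; rewrite rev_cons last_rcons.
have [|s] := @is_path_shorten _ (v m) (rev (belast (v 0%N) p) ++ q).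
  by rewrite cat_path l0 qq -lp path_rev.
by rewrite last_cat l0 lq => ms _; exists s.
Qed.

Lemma ray_acyclic : acyclic (ray_graph R).
Proof.
move=> c c2 cc.
have [m [mc mmax]] : exists m, v m \in c /\ forall n, v n \in c -> (n <= m)%N.
  have : (0 < size c)%N by exact: leq_trans c2.
  elim: c {c2 cc} => // x c IHc _; have [n xn] := ray_index x; subst x.
  have xc k : v k \in v n :: c -> k = n \/ v k \in c.
    by rewrite inE => /orP[/eqP/ray_vertex_inj|]; [left|right].
  case: c IHc xc => [_ xc|y c /(_ isT)[m [mc mmax]] xc].
    by exists n; rewrite mem_head; split=> // k /xc[->|].
  have [mn|nm] := leqP m n.
    exists n; rewrite mem_head; split=> // k /xc[->//|/mmax km].
    exact: leq_trans mn.
  exists m; rewrite inE mc orbT; split=> // k /xc[->|/mmax//].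
  exact: ltnW.
have nbr n : v n \in c -> adj (v m) (v n) -> m = n.+1.
  by move=> /mmax nm /ray_adj_cases[e|//]; rewrite e ltnn in nm.
have [i s e] := rot_to mc.
have : ucycle (@adj (ray_graph R)) (v m :: s).
  by rewrite -e /ucycle rot_cycle rot_uniq.
have : (2 < size (v m :: s))%N by rewrite -e size_rot.
have sc y : y \in s -> y \in c.
  by move=> ys; rewrite -(mem_rot i) e inE ys orbT.
case: s sc {e} => [|a s] // sc.
case/lastP: s sc => [|s z] // sc _; rewrite /ucycle /= -rcons_cons.
rewrite !rcons_path /= last_rcons.
have as_ : a \in a :: rcons s z by rewrite mem_head.
have zs : z \in a :: rcons s z by rewrite inE mem_rcons mem_head orbT.
move=> /andP[/andP[ma /andP[_ mz]] /and3P[_ naz _]].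
have [ia ea] := ray_index a; have [iz ez] := ray_index z.
have := sc _ as_; have := sc _ zs; subst a z => zc ac.
rewrite adj_sym in mz.
have := nbr _ zc mz; rewrite (nbr _ ac ma) => -[eaz].
by move: naz; rewrite eaz mem_rcons mem_head.
Qed.

Lemma ray_is_tree : is_tree (ray_graph R).
Proof.
by split; [exact: inhabits (v 0%N)|exact: ray_connected|exact: ray_acyclic].
Qed.

End RayIsTree.

Coercion ray_tree (R : ray) : tree := Tree (ray_is_tree R).

Section LabelDist.
Variables (K : realType) (T : tree) (l : labeling K T).

Lemma label_distxx x : label_dist l x x = 0.
Proof. by rewrite /label_dist eqxx. Qed.

Lemma label_dist_ge0 x y : 0 <= label_dist l x y.
Proof.
rewrite /label_dist; case: ifP => // _.
exact: bigmax_ge_id.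
Qed.

Lemma label_dist_walk u p : path (@adj T) u p ->
  label_dist l u (last u p) <= \big[Num.max/0]_(w <- u :: p) (l w)%:num.
Proof.
move=> up; rewrite /label_dist; case: ifP => _; first exact: bigmax_ge_id.
exact/sub_bigmax_seq/tree_path_sub.
Qed.

Lemma label_dist_pos : non_degenerate l ->
  forall x y, label_dist l x y = 0 -> x = y.
Proof.
move=> hl x y; rewrite /label_dist; case: eqVneq => // nxy.
case: (tree_path x y) (tree_pathP x y) => [|a p].
  by case/and3P=> _ _ /eqP /= xy; rewrite xy eqxx in nxy.
case/and3P=> /= /andP[xa _] _ _ e; have := hl _ _ xa.
rewrite ltNge -[X in _ <= X]e ge_max.
case/negP; apply/andP; split; apply: (@le_bigmax_seq _ _ _ _ _ _ _ (fun w => (l w)%:num));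
  by rewrite ?inE ?eqxx ?orbT.
Qed.

Lemma label_dist_sym x y : label_dist l x y = label_dist l y x.
Proof.
wlog suff h : x y / label_dist l x y <= label_dist l y x.
  by apply/eqP; rewrite eq_le !h.
have [->//|nxy] := eqVneq x y.
have /and3P[yp _ /eqP lp] := tree_pathP y x.
set p := tree_path y x in yp lp.
have eqp : x :: rev (belast y p) = rev (y :: p).
  by rewrite [y :: p]lastI rev_rcons lp.
have lr : last x (rev (belast y p)) = y.
  by rewrite -(last_cons x) eqp rev_cons last_rcons.
have := @label_dist_walk x (rev (belast y p)).
rewrite lr -[X in path _ X _]lp path_rev // => /(_ isT) /le_trans; apply.
rewrite /label_dist eq_sym (negbTE nxy).
by apply: sub_bigmax_seq => w; rewrite eqp mem_rev.
Qed.

Lemma label_dist_ultra x y z :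
  label_dist l x z <= Num.max (label_dist l x y) (label_dist l y z).
Proof.
have [->|nxy] := eqVneq x y; first by rewrite label_distxx le_max lexx orbT.
have [->|nyz] := eqVneq y z; first by rewrite le_max lexx.
have /and3P[xp _ /eqP lp] := tree_pathP x y.
have /and3P[yq _ /eqP lq] := tree_pathP y z.
have := @label_dist_walk x (tree_path x y ++ tree_path y z).
rewrite cat_path last_cat lp xp yq lq => /(_ isT) /le_trans; apply.
rewrite /label_dist (negbTE nxy) (negbTE nyz).
rewrite big_seq; apply: bigmax_le => [|w]; first by rewrite le_max bigmax_ge_id.
rewrite -cat_cons mem_cat => /orP[wp|wq]; rewrite le_max.
  by rewrite (@le_bigmax_seq _ _ _ _ _ _ _ (fun w => (l w)%:num)).
by rewrite orbC (@le_bigmax_seq _ _ _ _ _ _ _ (fun w => (l w)%:num)) // inE wq orbT.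
Qed.

Lemma label_dist_triangle y x z :
  label_dist l x z <= label_dist l x y + label_dist l y z.
Proof.
apply: le_trans (label_dist_ultra x y z) _.
by rewrite ge_max lerDl lerDr !label_dist_ge0.
Qed.

End LabelDist.

(* V(T) carrying the metric [label_dist l]; the proof [hl] makes it one. *)
Definition label_space (K : realType) (T : tree) (l : labeling K T)
  (hl : non_degenerate l) : Type := T.

Section LabelSpace.
Variables (K : realType) (T : tree) (l : labeling K T) (hl : non_degenerate l).

HB.instance Definition _ := Choice.on (label_space hl).
HB.instance Definition _ := isMetric.Build K (label_space hl)
  (@label_distxx K T l) (label_dist_pos hl) (@label_dist_sym K T l)
  (@label_dist_triangle K T l).

Lemma mdist_label_spaceE (x y : label_space hl) : mdist x y = label_dist l x y.
Proof. by []. Qed.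

End LabelSpace.

Definition ultrametric (K : realType) (M : metricType K) : Prop :=
  forall x y z : M, mdist x z <= Num.max (mdist x y) (mdist y z).

Lemma label_space_ultrametric (K : realType) (T : tree) (l : labeling K T)
  (hl : non_degenerate l) : ultrametric (label_space hl).
Proof. by move=> x y z; exact: label_dist_ultra. Qed.

Definition metric_bounded (K : realType) (M : metricType K) (A : set M) : Prop :=
  exists (c : M) (r : K), 0 < r /\ A `<=` [set x | mdist c x <= r].

Definition locally_finite_space (K : realType) (M : metricType K) : Prop :=
  forall A : set M, metric_bounded A -> finite_set A.

(* Main.v *)
Require Import Defs.
From HB Require Import structures.
From mathcomp Require Import all_boot all_order all_algebra.
From mathcomp Require Import all_classical all_reals all_analysis.

Set Implicit Arguments.
Unset Strict Implicit.
Unset Printing Implicit Defensive.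

Import Order.TTheory GRing.Theory Num.Theory.
Local Open Scope classical_set_scope.
Local Open Scope ring_scope.

(** The path from [v_m] to [v_n] with [m < n] runs through exactly
    [v_m, v_{m+1}, ..., v_n], so their distance is the largest label in that
    window ([label_dist_ray]).  Hence a label larger than [r] at index [n] is a
    barrier: no ball of radius [r] centred before [n] contains a vertex from
    index [n] on.  An infinite upper limit ([limn_esup_pinftyP]) puts such a
    barrier beyond every centre for every radius, so balls are finite.
    Conversely, if from some index [m] on all labels are at most [r], then the
    whole infinite tail starting at [v_m] lies in a ball around [v_m]. *)

(** The upper limit is an infimum of suprema over all neighborhoods of infinity;
    each contains a tail, so it is infinite exactly when [u] is unbounded above
    on every tail. *)
Lemma limn_esup_pinftyP (K : realType) (u : nat -> \bar K) :
  limn_esup u = +oo%E <->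
  forall (r : K) (m : nat), exists2 n, (m <= n)%N & (r%:E < u n)%E.
Proof.
rewrite /limn_esup limf_esupE ereal_inf_pinfty; split => [uoo r m|large x].
  have sup_tail : ereal_sup (u @` [set n | (m <= n)%N]) = +oo%E.
    by apply: uoo; exists [set n | (m <= n)%N] => //; exact: nbhs_infty_ge.
  have : (r%:E < ereal_sup (u @` [set n | (m <= n)%N]))%E.
    by rewrite sup_tail ltry.
  by move=> /ereal_sup_gt[_ [n mn <-]]; exists n.
case=> V [m _ mV] <-; apply/eqyP => r _.
have [n mn run] := large r m.
by apply: le_trans (ltW run) _; apply: ereal_sup_ubound; exists n => //; exact: mV.
Qed.

(** Paths in a tree are unique, so exhibiting this one determines the path that
    [label_dist] chooses. *)
Lemma ray_segment_is_path (R : ray) (m k : nat) :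
  is_path (ray_vertex R m) (ray_vertex R (m + k))
    (map (@ray_vertex R) (iota m.+1 k)).
Proof.
rewrite /is_path -map_cons (map_inj_uniq (@ray_vertex_inj R)).
rewrite -[m :: _]/(iota m k.+1) iota_uniq /=; apply/andP; split.
  by elim: k m => //= k IHk m; rewrite ray_adjS IHk.
by rewrite last_map; elim: k m => [|k IHk] m /=; rewrite ?addn0 ?addnS -?addSn.
Qed.

Lemma label_dist_ray (K : realType) (R : ray) (l : labeling K R) (m n : nat) :
  (m < n)%N ->
  label_dist l (ray_vertex R m) (ray_vertex R n) =
  \big[Num.max/0]_(m <= i < n.+1) (l (ray_vertex R i))%:num.
Proof.
move=> mn; rewrite /label_dist ifF; last first.
  by apply/eqP => /ray_vertex_inj mn'; rewrite mn' ltnn in mn.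
have := ray_segment_is_path R m (n - m); rewrite subnKC 1?ltnW//.
move=> /(@tree_path_unique R) ->; rewrite -map_cons big_map.
by rewrite /index_iota subSn 1?ltnW.
Qed.

(** The barrier estimate: getting from [v_m] past index [i] costs at least the
    label there. *)
Lemma label_dist_ray_ge (K : realType) (R : ray) (l : labeling K R)
    (m i n : nat) :
  (m < i <= n)%N ->
  (l (ray_vertex R i))%:num <= label_dist l (ray_vertex R m) (ray_vertex R n).
Proof.
move=> /andP[mi in_]; rewrite label_dist_ray; last exact: leq_trans in_.
apply: (@le_bigmax_seq _ _ _ _ _ _ _ (fun i => (l (ray_vertex R i))%:num)) => //.
by rewrite mem_index_iota ltnW// ltnS.
Qed.

Lemma label_dist_ray_le (K : realType) (R : ray) (l : labeling K R)
    (m n : nat) (r : K) :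
  (forall i, (m <= i)%N -> (l (ray_vertex R i))%:num <= r) -> (m <= n)%N ->
  label_dist l (ray_vertex R m) (ray_vertex R n) <= r.
Proof.
move=> lr; have r0 : 0 <= r by apply: le_trans (lr m (leqnn m)); exact: ge0.
rewrite leq_eqVlt => /predU1P[->|mn]; first by rewrite label_distxx.
rewrite label_dist_ray// big_nat; apply: bigmax_le => [//|i /andP[mi _]].
exact: lr.
Qed.

Theorem proposition4 (K : realType) (R : ray) (l : labeling K R)
    (hl : non_degenerate l) :
  locally_finite_space (label_space hl) <->
  limn_esup (fun n : nat => (l (ray_vertex R n))%:num%:E) = +oo%E.
Proof.
rewrite limn_esup_pinftyP; split => [locfin r m|large A [c [r [r0 Ar]]]].
- apply: contrapT => bounded.
  have tail_le i : (m <= i)%N -> (l (ray_vertex R i))%:num <= r.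
    move=> mi; rewrite leNgt; apply/negP => ri; apply: bounded.
    by exists i => //; rewrite lte_fin.
  have shift_inj : injective (fun i => ray_vertex R (m + i)).
    by move=> i j /ray_vertex_inj /addnI.
  apply: infinite_nat; rewrite -(eq_finite_set (inj_card_eq (in2W shift_inj))).
  apply: (locfin (range (fun i => ray_vertex R (m + i)))).
  (* Balls must have positive radius, whereas [r] is an arbitrary real. *)
  exists (ray_vertex R m), (Num.max r 1); split; first by rewrite lt_max ltr01 orbT.
  move=> _ [i _ <-] /=; rewrite mdist_label_spaceE le_max.
  by rewrite (label_dist_ray_le tail_le)// leq_addr.
- have [m cm] := ray_index (c : ray_graph R).
  have [n mn rn] := large r m.+1.
  apply: (@sub_finite_set _ _ (@ray_vertex R @` `I_n)); last first.
    exact/finite_image/finite_II.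
  move=> x /Ar /=; have [k <-] := ray_index (x : ray_graph R).
  rewrite mdist_label_spaceE -cm => dr; exists k => //=.
  rewrite ltnNge; apply/negP => nk.
  have : r < r; last by rewrite ltxx.
  apply: lt_le_trans (le_trans _ dr); first by rewrite -lte_fin; exact: rn.
  by apply: label_dist_ray_ge; rewrite mn.
Qed.
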